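(* Let $(A,\Gamma)$ be a graded Hopf algebroid with $\Gamma$ flat over $A$, and let $V:\mathrm{gr\,Comod}(\Gamma)\to\mathrm{gr\,Mod}(A)$ be the right adjoint of the extended comodule functor $E:\mathrm{gr\,Mod}(A)\to\mathrm{gr\,Comod}(\Gamma)$, $E(M)=\Gamma\otimes_AM$ (this right adjoint exists). Then $V$ is co-represented by the comodule $\Gamma$: there is an isomorphism of graded abelian groups $$\hom_{\mathrm{gr\,Comod}(\Gamma)}(\Gamma,M)\cong V(M),$$ natural in the graded $\Gamma$-comodule $M$.
   Context: Comodules are graded left $\Gamma$-comodules. $\hom_{\mathrm{gr\,Comod}(\Gamma)}(M,N)$ denotes the graded abelian group whose degree $n$ part is the group of grading-preserving comodule homomorphisms $\Sigma^nM\to N$, where $\Sigma M$ is $M$ with all degrees increased by $1$. Flatness of $(A,\Gamma)$ (equivalently, of either unit map $A\to\Gamma$) ensures that $\mathrm{gr\,Comod}(\Gamma)$ is an abelian category. *)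

(* Defs.v *)
From HB Require Import structures.
From mathcomp Require Import all_boot all_order all_algebra.
From mathcomp Require Import ring_quotient.
From mathcomp Require Import boolp classical_sets functions.
From mathcomp Require Import freeg.

Set Implicit Arguments.
Unset Strict Implicit.
Unset Printing Implicit Defensive.

Import GRing.Theory.
Local Open Scope ring_scope.

Inductive span (V : zmodType) (S : V -> Prop) : V -> Prop :=
| span0 : span S 0
| spanB u v of span S u & span S v : span S (u - v)
| span_gen u of S u : span S u.

Lemma spanN (V : zmodType) (S : V -> Prop) u : span S u -> span S (- u).
Proof. by move=> h; rewrite -[- u]sub0r; apply: spanB => //; apply: span0. Qed.

Lemma spanD (V : zmodType) (S : V -> Prop) u v :
  span S u -> span S v -> span S (u + v).
Proof. by move=> hu hv; rewrite -[v]opprK; apply/spanB/spanN. Qed.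

Lemma zmod_morphD (V W : zmodType) (f : V -> W) :
  {morph f : u v / u + v} -> zmod_morphism f.
Proof.
move=> fD u v; apply: (addIr (f v)).
by rewrite -fD !subrK.
Qed.

Section ZmodMorph.
Variables (V W : zmodType) (f : V -> W).
Hypothesis fB : zmod_morphism f.

Let f' : {additive V -> W} :=
  HB.pack f (GRing.isZmodMorphism.Build V W f fB).

Lemma zmodm0 : f 0 = 0. Proof. exact: (raddf0 f'). Qed.
Lemma zmodmN u : f (- u) = - f u. Proof. exact: (raddfN f'). Qed.
Lemma zmodmD u v : f (u + v) = f u + f v. Proof. exact: (raddfD f'). Qed.
Lemma zmodm_sum (I : Type) (s : seq I) (F : I -> V) :
  f (\sum_(i <- s) F i) = \sum_(i <- s) f (F i).
Proof. exact: (raddf_sum f'). Qed.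

End ZmodMorph.

Section QuotientBySpan.
Variables (V : zmodType) (S : V -> Prop).

Definition span_pred : {pred V} := [pred u | `[< span S u >]].

Lemma span_predP u : reflect (span S u) (u \in span_pred).
Proof. exact: asboolP. Qed.

Lemma span_pred_closed : zmod_closed span_pred.
Proof.
split=> [|u v]; first by apply/span_predP; apply: span0.
by move=> /span_predP hu /span_predP hv; apply/span_predP/spanB.
Qed.

HB.instance Definition _ := GRing.isZmodClosed.Build V span_pred span_pred_closed.

Definition zquo : Type := Quotient.quot span_pred.

HB.instance Definition _ := Choice.on zquo.
HB.instance Definition _ := GRing.Zmodule.on zquo.

Definition zpi (u : V) : zquo := (\pi_(Quotient.quot span_pred) u)%qT.

Definition zrepr (u : zquo) : V := repr (u : Quotient.quot span_pred).

Lemma zreprK u : zpi (zrepr u) = u.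
Proof. exact: reprK. Qed.

Lemma zpi_additive : zmod_morphism zpi.
Proof. exact: pi_is_zmod_morphism. Qed.

Lemma zpiD u v : zpi (u + v) = zpi u + zpi v.
Proof. exact: zmodmD zpi_additive u v. Qed.

Lemma zpi_eqP u v : reflect (span S (u - v)) (zpi u == zpi v).
Proof.
have -> : (zpi u == zpi v) = (u - v \in span_pred).
  exact: esym (Quotient.idealrBE span_pred u v).
exact: span_predP.
Qed.

Lemma zpiP u v : span S (u - v) -> zpi u = zpi v.
Proof. by move=> h; apply/eqP/zpi_eqP. Qed.

End QuotientBySpan.

Definition fgen (G M : choiceType) (x : G) (m : M) : {freeg (G * M)} :=
  Freeg [:: (1 : int, (x, m))].

Inductive tens_rel (A G : pzRingType) (r : {rmorphism A -> G})
    (M : lmodType A) : {freeg (G * M)} -> Prop :=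
| tens_relDl x y m : tens_rel r (fgen (x + y) m - fgen x m - fgen y m)
| tens_relDr x m n : tens_rel r (fgen x (m + n) - fgen x m - fgen x n)
| tens_relA x a m : tens_rel r (fgen (x * r a) m - fgen x (a *: m)).

(* G (x)_A M, where G is a right A-module through r; its left A-module
   structure, defined below, is the one coming from l. *)
Definition tens (A G : pzRingType) (l r : {rmorphism A -> G})
  (M : lmodType A) : Type := zquo (@tens_rel A G r M).

Section Tensor.
Variables (A G : pzRingType) (l r : {rmorphism A -> G}) (M : lmodType A).

Local Notation F := {freeg (G * M)}.
Local Notation tens_rel := (@tens_rel A G r M).
Local Notation tens := (@tens A G l r M).

HB.instance Definition _ := GRing.Zmodule.on tens.

Definition tpure (x : G) (m : M) : tens := zpi tens_rel (fgen x m).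

(* The map induced by b, provided that b is balanced (see tliftE). *)
Definition tlift (Z : zmodType) (b : G -> M -> Z) (u : tens) : Z :=
  fglift (fun p => b p.1 p.2 : zmodule Z) (zrepr u).

Record balanced (Z : zmodType) (b : G -> M -> Z) : Prop := Balanced {
  balDl : forall x y m, b (x + y) m = b x m + b y m;
  balDr : forall x m n, b x (m + n) = b x m + b x n;
  balA : forall x a m, b (x * r a) m = b x (a *: m) }.

Let tpi : F -> tens := @zpi _ tens_rel.

Let tpi_additive : zmod_morphism tpi.
Proof. exact: zpi_additive. Qed.

Let tpi_eq (u v : F) : tpi u = tpi v -> span tens_rel (u - v).
Proof. by move=> /eqP/zpi_eqP. Qed.

Let tpi_repr (u : tens) : tpi (zrepr u) = u.
Proof. exact: zreprK. Qed.

Lemma tpureDl x y m : tpure (x + y) m = tpure x m + tpure y m.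
Proof.
rewrite /tpure -zpiD; apply: zpiP; rewrite opprD addrA.
exact: (span_gen (tens_relDl r x y m)).
Qed.

Lemma tpureDr x m n : tpure x (m + n) = tpure x m + tpure x n.
Proof.
rewrite /tpure -zpiD; apply: zpiP; rewrite opprD addrA.
exact: (span_gen (tens_relDr r x m n)).
Qed.

Lemma tpureA x a m : tpure (x * r a) m = tpure x (a *: m).
Proof. by apply: zpiP; exact: (span_gen (tens_relA r x a m)). Qed.

Lemma tpure_balanced : balanced tpure.
Proof. by split; [exact: tpureDl|exact: tpureDr|exact: tpureA]. Qed.

Lemma tpi_mulz (u : F) (k : int) : tpi (u *~ k) = tpi u *~ k.
Proof.
have nat n : tpi (u *+ n) = tpi u *+ n.
  elim: n => [|n IH]; first exact: zmodm0 tpi_additive.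
  by rewrite !mulrS (zmodmD tpi_additive) IH.
case: k => n; first exact: nat.
by rewrite NegzE !mulrNz (zmodmN tpi_additive); congr (- _); exact: nat.
Qed.

Lemma tensE (u : tens) :
  exists s : seq (int * (G * M)), u = \sum_(p <- s) tpure p.2.1 p.2.2 *~ p.1.
Proof.
exists [seq (coeff z (zrepr u), z) | z <- dom (zrepr u)].
rewrite big_map -[LHS]tpi_repr -{1}[zrepr u]freeg_sumE.
rewrite (zmodm_sum tpi_additive); apply: eq_bigr => -[x m] _ /=.
by rewrite -[tpure x m]/(tpi (fgen x m)) -tpi_mulz /fgen freegU_mulz intz.
Qed.

Lemma tens_ind (P : tens -> Prop) :
  P 0 -> (forall u v, P u -> P v -> P (u - v)) ->
  (forall x m, P (tpure x m)) -> forall u, P u.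
Proof.
move=> P0 PB Pp u.
have PN v : P v -> P (- v) by move=> Pv; rewrite -sub0r; apply: PB.
have PD v w : P v -> P w -> P (v + w).
  by move=> Pv Pw; rewrite -[w]opprK; apply/PB/PN.
have [s ->] := tensE u.
elim: s => [|[k [x m]] s IH]; rewrite ?big_nil ?big_cons //=.
have Pn n : P (tpure x m *+ n).
  by elim: n => [|n IHn]; rewrite ?mulr0n // mulrS; apply: PD.
apply: PD => //.
by case: k => n; rewrite ?NegzE ?mulrNz; [|apply: PN]; exact: Pn.
Qed.

Section Lift.
Variables (Z : zmodType) (b : G -> M -> Z).
Hypothesis bal_b : balanced b.

Let bl (u : F) : Z := fglift (fun p => b p.1 p.2 : zmodule Z) u.

Let bl_additive : zmod_morphism bl.
Proof. exact: (lift_is_additive (fun p => b p.1 p.2 : zmodule Z)). Qed.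

Let bl_gen x m : bl (fgen x m) = b x m.
Proof. by rewrite /bl /fgen liftU scale1r. Qed.

Let bl_ker u : span tens_rel u -> bl u = 0.
Proof.
elim=> [|v w _ hv _ hw|v]; first exact: zmodm0 bl_additive.
  by rewrite bl_additive hv hw subr0.
case=> *; rewrite !bl_additive !bl_gen ?(balDl bal_b) ?(balDr bal_b).
- by rewrite -addrA -opprD subrr.
- by rewrite -addrA -opprD subrr.
- by rewrite (balA bal_b) subrr.
Qed.

Let tlift_pi u : tlift b (tpi u) = bl u.
Proof.
apply/eqP; rewrite -subr_eq0 -[tlift _ _]/(bl _) -bl_additive; apply/eqP.
by apply: bl_ker; apply: tpi_eq; rewrite tpi_repr.
Qed.

Lemma tliftE x m : tlift b (tpure x m) = b x m.
Proof. by rewrite tlift_pi bl_gen. Qed.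

Lemma tlift_additive : zmod_morphism (tlift b).
Proof.
move=> u v; rewrite -(tpi_repr u) -(tpi_repr v) -tpi_additive.
by rewrite !tlift_pi bl_additive.
Qed.

End Lift.

Lemma tens_ext (Z : zmodType) (f g : tens -> Z) :
  zmod_morphism f -> zmod_morphism g ->
  (forall x m, f (tpure x m) = g (tpure x m)) -> f =1 g.
Proof.
move=> fB gB fg; apply: tens_ind => [|u v hu hv|//].
  by rewrite (zmodm0 fB) (zmodm0 gB).
by rewrite fB gB hu hv.
Qed.

Definition tscale (a : A) : tens -> tens :=
  tlift (fun x m => tpure (l a * x) m).

Let tscale_bal a : balanced (fun x m => tpure (l a * x) m).
Proof. by split=> *; rewrite ?mulrDr ?tpureDl ?tpureDr ?mulrA ?tpureA. Qed.

Lemma tscaleE a x m : tscale a (tpure x m) = tpure (l a * x) m.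
Proof. exact: tliftE (tscale_bal a) _ _. Qed.

Let tscaleB a : zmod_morphism (tscale a).
Proof. exact: tlift_additive (tscale_bal a). Qed.

Fact tscaleA a b u : tscale a (tscale b u) = tscale (a * b) u.
Proof.
move: u; apply: tens_ext => [u v|//|x m]; first by rewrite !tscaleB.
by rewrite !tscaleE rmorphM mulrA.
Qed.

Fact tscale1 : left_id 1 tscale.
Proof. by apply: tens_ext => // x m; rewrite tscaleE rmorph1 mul1r. Qed.

Fact tscaleDr : right_distributive tscale +%R.
Proof. by move=> a u v; rewrite (zmodmD (tscaleB a)). Qed.

Fact tscaleDl u : {morph tscale^~ u : a b / a + b}.
Proof.
move=> a b; move: u; apply: tens_ext => [u v|u v|x m].
- by rewrite !tscaleB.
- by rewrite !tscaleB opprD addrACA.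
- by rewrite !tscaleE rmorphD mulrDl tpureDl.
Qed.

HB.instance Definition _ := GRing.Zmodule_isLmodule.Build A tens
  tscaleA tscale1 tscaleDr tscaleDl.

Lemma tpureZ a x m : a *: tpure x m = tpure (l a * x) m.
Proof. exact: tscaleE. Qed.

End Tensor.

(* G regarded as a left A-module through l. *)
Definition lreg (A G : pzRingType) (l : {rmorphism A -> G}) : Type := G.

Section LReg.
Variables (A G : pzRingType) (l : {rmorphism A -> G}).

HB.instance Definition _ := GRing.Zmodule.on (lreg l).

Definition lreg_scale (a : A) (x : lreg l) : lreg l := l a * (x : G).

Fact lreg_scaleA a b x : lreg_scale a (lreg_scale b x) = lreg_scale (a * b) x.
Proof. by rewrite /lreg_scale rmorphM mulrA. Qed.

Fact lreg_scale1 : left_id 1 lreg_scale.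
Proof. by move=> x; rewrite /lreg_scale rmorph1 mul1r. Qed.

Fact lreg_scaleDr : right_distributive lreg_scale +%R.
Proof. by move=> a x y; apply: mulrDr. Qed.

Fact lreg_scaleDl x : {morph lreg_scale^~ x : a b / a + b}.
Proof. by move=> a b; rewrite /lreg_scale rmorphD mulrDl. Qed.

HB.instance Definition _ := GRing.Zmodule_isLmodule.Build A (lreg l)
  lreg_scaleA lreg_scale1 lreg_scaleDr lreg_scaleDl.

Lemma lregZ a (x : lreg l) : a *: x = l a * (x : G) :> G.
Proof. by []. Qed.

End LReg.

Section LinearHelpers.
Variables (A : pzRingType) (M N : lmodType A) (f : M -> N).
Hypothesis fL : linear f.

Let f' : {linear M -> N} := HB.pack f (GRing.isLinear.Build A M N *:%R f fL).

Lemma lin_additive : zmod_morphism f.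
Proof. exact: (raddfB f'). Qed.
Lemma linD u v : f (u + v) = f u + f v. Proof. exact: (raddfD f'). Qed.
Lemma lin0 : f 0 = 0. Proof. exact: (raddf0 f'). Qed.
Lemma linZ a u : f (a *: u) = a *: f u. Proof. by have := fL a u 0; rewrite addr0 lin0 addr0. Qed.

End LinearHelpers.

Lemma linI (A : pzRingType) (M N : lmodType A) (f : M -> N) :
  zmod_morphism f -> (forall a u, f (a *: u) = a *: f u) -> linear f.
Proof. by move=> fB fZ a u v; rewrite (zmodmD fB) fZ. Qed.

Section TensorMap.
Variables (A G : pzRingType) (l r : {rmorphism A -> G}).

Lemma tens_lin (M : lmodType A) (N : lmodType A) (f : tens l r M -> N) :
  zmod_morphism f ->
  (forall a x m, f (tpure l r (l a * x) m) = a *: f (tpure l r x m)) ->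
  linear f.
Proof.
move=> fB fZ; apply: linI => // a; apply: tens_ext => [u v|u v|x m].
- by rewrite scalerBr fB.
- by rewrite fB scalerBr.
- by rewrite tpureZ fZ.
Qed.

(* G (x)_A f *)
Definition tmap (M N : lmodType A) (f : M -> N) : tens l r M -> tens l r N :=
  tlift (fun x m => tpure l r x (f m)).

Section TmapLemmas.
Variables (M N : lmodType A) (f : M -> N).
Hypothesis fL : linear f.

Let tmap_bal : balanced r (fun x m => tpure l r x (f m)).
Proof. by split=> *; rewrite ?tpureDl ?tpureA ?(linD fL) ?tpureDr ?(linZ fL). Qed.

Lemma tmapE x m : tmap f (tpure l r x m) = tpure l r x (f m).
Proof. exact: tliftE tmap_bal _ _. Qed.

Lemma tmap_linear : linear (tmap f).
Proof.
apply: tens_lin => [|a x m]; first exact: tlift_additive tmap_bal.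
by rewrite !tmapE tpureZ.
Qed.

End TmapLemmas.

Lemma tmap_id (M : lmodType A) : tmap (@id M) =1 id.
Proof.
have idL : linear (@id M) by [].
by apply: tens_ext => [||x m]; [exact: lin_additive (tmap_linear idL)| |rewrite tmapE].
Qed.

Lemma tmap_comp (M N P : lmodType A) (f : N -> P) (g : M -> N) :
  linear f -> linear g -> tmap (f \o g) =1 tmap f \o tmap g.
Proof.
move=> fL gL; have fgL : linear (f \o g) by move=> a u v /=; rewrite gL fL.
apply: tens_ext => [|u v|x m /=]; first exact: lin_additive (tmap_linear fgL).
  by rewrite /= (lin_additive (tmap_linear gL)) (lin_additive (tmap_linear fL)).
by rewrite !tmapE.
Qed.

Lemma tpure_linear (M : lmodType A) (m : M) :
  linear (fun x : lreg l => tpure l r x m).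
Proof. by move=> a x y; rewrite tpureDl tpureZ. Qed.

End TensorMap.

Arguments tmap {A G} l r {M N} f u.

(* V is the internal direct sum of the subgroups gr n, n : int. *)
Record is_grading (V : zmodType) (gr : int -> V -> Prop) : Prop := IsGrading {
  grading0 : forall n, gr n 0;
  gradingB : forall n u v, gr n u -> gr n v -> gr n (u - v);
  grading_dec : forall v, exists p : seq int * (int -> V),
    [/\ uniq p.1, forall i, gr i (p.2 i) & v = \sum_(i <- p.1) p.2 i];
  grading_indep : forall (s : seq int) (c : int -> V), uniq s ->
    (forall i, gr i (c i)) -> \sum_(i <- s) c i = 0 ->
    forall i, i \in s -> c i = 0 }.

Section Grading.
Variables (V : zmodType) (gr : int -> V -> Prop).

Definition decomposed v (p : seq int * (int -> V)) :=
  [/\ uniq p.1, forall i, gr i (p.2 i) & v = \sum_(i <- p.1) p.2 i].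

Lemma big_extend0 (W : zmodType) (F : int -> V -> W) (s w : seq int) c :
  (forall i, F i 0 = 0) -> uniq s -> uniq w -> {subset s <= w} ->
  \sum_(i <- s) F i (c i) = \sum_(i <- w) F i (if i \in s then c i else 0).
Proof.
move=> F0 us uw sw.
rewrite [RHS](eq_bigr (fun i => if i \in s then F i (c i) else 0)); last first.
  by move=> i _; case: ifP.
rewrite -big_mkcond -big_filter; apply: perm_big; apply: uniq_perm => //.
  exact: filter_uniq.
by move=> i; rewrite mem_filter; case: (boolP (i \in s)) => //= /sw ->.
Qed.

Hypothesis gr0 : forall n, gr n 0.
Hypothesis grB : forall n u v, gr n u -> gr n v -> gr n (u - v).

Lemma decomposedB u v p q : decomposed u p -> decomposed v q ->
  decomposed (u - v) (undup (p.1 ++ q.1),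
    fun i => (if i \in p.1 then p.2 i else 0) - (if i \in q.1 then q.2 i else 0)).
Proof.
case: p q => [s c] [t d] [/= us gc ->] [/= ut gd ->]; split=> /= [|i|].
- exact: undup_uniq.
- by apply: grB; case: ifP.
- rewrite big_split sumrN /=; congr (_ - _).
    apply: (@big_extend0 V (fun=> id)); rewrite ?undup_uniq // => i.
    by rewrite mem_undup mem_cat => ->.
  apply: (@big_extend0 V (fun=> id)); rewrite ?undup_uniq // => i.
  by rewrite mem_undup mem_cat => ->; rewrite orbT.
Qed.

Lemma decomposed_homog i v : gr i v ->
  decomposed v ([:: i], fun j => if j == i then v else 0).
Proof. by move=> gv; split=> //= [j|]; [case: eqP => [->|] | rewrite big_seq1 eqxx]. Qed.

End Grading.

Section GradedSum.
Variables (V : zmodType) (gr : int -> V -> Prop) (grP : is_grading gr).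

Let gr0 := grading0 grP.
Let grB := gradingB grP.

Lemma gradingN n u : gr n u -> gr n (- u).
Proof. by move=> h; rewrite -sub0r; apply: grB. Qed.

Lemma gradingD n u v : gr n u -> gr n v -> gr n (u + v).
Proof. by move=> hu hv; rewrite -[v]opprK; apply/grB/gradingN. Qed.

Definition gdec (v : V) : seq int * (int -> V) :=
  sval (cid (grading_dec grP v)).

Lemma gdecP v : decomposed gr v (gdec v).
Proof. exact: svalP (cid (grading_dec grP v)). Qed.

(* The sum of the F i (v_i), where v_i is the degree i component of v. *)
Definition gsum (W : zmodType) (F : int -> V -> W) (v : V) : W :=
  \sum_(i <- (gdec v).1) F i ((gdec v).2 i).

Section GsumTheory.
Variables (W : zmodType) (F : int -> V -> W).

Lemma gsumE v p : (forall i, F i 0 = 0) -> decomposed gr v p ->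
  gsum F v = \sum_(i <- p.1) F i (p.2 i).
Proof.
move=> F0 vp; have vq := gdecP v; rewrite /gsum; set q := gdec v in vq *.
have := decomposedB gr0 grB vp vq; rewrite subrr => -[/= uw gw /esym S0].
have e := grading_indep grP uw gw S0.
have [up gp _] := vp; have [uq gq _] := vq.
rewrite (@big_extend0 _ _ F p.1 (undup (p.1 ++ q.1))) ?undup_uniq //; last first.
  by move=> i; rewrite mem_undup mem_cat => ->.
rewrite (@big_extend0 _ _ F q.1 (undup (p.1 ++ q.1))) ?undup_uniq //; last first.
  by move=> i; rewrite mem_undup mem_cat => ->; rewrite orbT.
rewrite !big_seq; apply: eq_bigr => i /e /eqP.
by rewrite subr_eq0 => /eqP ->.
Qed.

Hypothesis FB : forall i, zmod_morphism (F i).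

Let F0 i : F i 0 = 0. Proof. exact: zmodm0 (FB i). Qed.

Lemma gsum_additive : zmod_morphism (gsum F).
Proof.
move=> u v; rewrite (gsumE F0 (decomposedB gr0 grB (gdecP u) (gdecP v))) /=.
under eq_bigr do rewrite FB; rewrite big_split sumrN /=.
have [uu _ _] := gdecP u; have [uv _ _] := gdecP v.
congr (_ - _); rewrite /gsum; symmetry; apply: big_extend0;
  rewrite ?undup_uniq // => i; rewrite mem_undup mem_cat => -> //.
by rewrite orbT.
Qed.

Lemma gsum_homog i v : gr i v -> gsum F v = F i v.
Proof.
move=> gv; rewrite (gsumE F0 (decomposed_homog gr0 gv)) /=.
by rewrite big_seq1 eqxx.
Qed.

End GsumTheory.

Lemma gr_ext (W : zmodType) (f g : V -> W) :
  zmod_morphism f -> zmod_morphism g ->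
  (forall i v, gr i v -> f v = g v) -> f =1 g.
Proof.
move=> fB gB fg v; have [_ gp ->] := gdecP v.
rewrite (zmodm_sum fB) (zmodm_sum gB); apply: eq_bigr => i _.
exact: fg (gp i).
Qed.

Lemma gsum_const (W : zmodType) (f : V -> W) : zmod_morphism f ->
  gsum (fun=> f) =1 f.
Proof.
move=> fB v; rewrite {2}(_ : v = \sum_(i <- (gdec v).1) (gdec v).2 i) ?zmodm_sum //.
by have [] := gdecP v.
Qed.

End GradedSum.

(* The Koszul sign (-1)^(ij). *)
Definition ksign (i j : int) : int := (-1) ^ (i * j).

Record gcRing := GcRing {
  rcar :> pzRingType;
  rgr : int -> rcar -> Prop;
  rgrP : is_grading rgr;
  rgr1 : rgr 0 1;
  rgrM : forall i j x y, rgr i x -> rgr j y -> rgr (i + j) (x * y);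
  rgrC : forall i j x y, rgr i x -> rgr j y -> x * y = (y * x) *~ ksign i j }.

Record grMod (A : gcRing) := GrMod {
  mcar :> lmodType A;
  mgr : int -> mcar -> Prop;
  mgrP : is_grading mgr;
  mgrZ : forall i j (a : A) m, rgr i a -> mgr j m -> mgr (i + j) (a *: m) }.

Definition deg_preserving (U V : Type) (gU : int -> U -> Prop)
    (gV : int -> V -> Prop) (f : U -> V) : Prop :=
  forall n u, gU n u -> gV n (f u).

Section GradedTensor.
Variables (A G : gcRing) (l r : {rmorphism A -> G}).
Hypotheses (l_deg : deg_preserving (@rgr A) (@rgr G) l)
  (r_deg : deg_preserving (@rgr A) (@rgr G) r).

Definition tgr (M : lmodType A) (gM : int -> M -> Prop) (n : int) :
    tens l r M -> Prop :=
  span (fun u => exists i j x m,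
    [/\ i + j = n, @rgr G i x, gM j m & u = tpure l r x m]).

Lemma tgr_tpure (M : lmodType A) (gM : int -> M -> Prop) i j x m :
  @rgr G i x -> gM j m -> tgr gM (i + j) (tpure l r x m).
Proof. by move=> gx gm; apply: span_gen; exists i, j, x, m. Qed.

Section TensorGrading.
Variable M : grMod A.

Local Notation tg := (@tgr M (@mgr A M)).

Let b (n : int) (x : G) (m : M) : tens l r M :=
  gsum (@rgrP G) (fun i x => gsum (@mgrP A M) (fun j m =>
    if i + j == n then tpure l r x m else 0) m) x.

Let bodyBr (n i : int) (x : G) : forall j : int, zmod_morphism (fun m : M =>
    if i + j == n then tpure l r x m else 0).
Proof.
move=> j; apply: zmod_morphD => m m'; case: ifP; rewrite ?addr0 //.
by rewrite tpureDr.
Qed.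

Let bodyBl (n : int) (m : M) : forall i : int, zmod_morphism (fun x : G =>
  gsum (@mgrP A M) (fun j m => if i + j == n then tpure l r x m else 0) m).
Proof.
move=> i; apply: zmod_morphD => x y; rewrite /gsum -big_split; apply: eq_bigr => j _ /=.
by case: ifP; rewrite ?addr0 // tpureDl.
Qed.

Let bBl n m : zmod_morphism ((b n)^~ m).
Proof. exact: gsum_additive (bodyBl n m). Qed.

Let bBr n x : zmod_morphism (b n x).
Proof.
apply: zmod_morphD => m m'; rewrite /b /gsum -big_split; apply: eq_bigr => i _.
exact: zmodmD (gsum_additive _ (@bodyBr n i _)) _ _.
Qed.

Let b_homog n i j x m : rgr i x -> mgr j m ->
  b n x m = if i + j == n then tpure l r x m else 0.
Proof.
move=> gx gm; rewrite /b (gsum_homog _ (bodyBl n m) gx).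
by rewrite (gsum_homog _ (@bodyBr n i _) gm).
Qed.

Let b_bal n : balanced r (b n).
Proof.
split=> [x y m|x m m'|]; [exact: zmodmD (bBl n m) _ _|exact: zmodmD (bBr n x) _ _|].
move=> x a m; move: m; apply: (gr_ext (@mgrP A M)).
- exact: bBr.
- by move=> m m'; rewrite scalerBr bBr.
move=> k m gm; move: a; apply: (gr_ext (@rgrP A)).
- by move=> a c; rewrite rmorphB mulrBr bBl.
- by move=> a c; rewrite scalerBl bBr.
move=> j a ga; move: x; apply: (gr_ext (@rgrP G)).
- by move=> x y; rewrite mulrBl bBl.
- exact: bBl.
move=> i x gx; rewrite (b_homog n (rgrM gx (r_deg ga)) gm).
rewrite (b_homog n gx (mgrZ ga gm)) addrA; case: ifP => // _.
by rewrite tpureA.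
Qed.

Let proj (n : int) : tens l r M -> tens l r M := tlift (b n).

Let projB n : zmod_morphism (proj n).
Proof. exact: tlift_additive (b_bal n). Qed.

Let proj_tg k n u : tg k u -> proj n u = if k == n then u else 0.
Proof.
elim=> [|v w _ hv _ hw|v [i [j [x [m [<- gx gm ->]]]]]].
- by rewrite (zmodm0 (projB n)) if_same.
- by rewrite projB hv hw; case: ifP; rewrite ?subr0.
- by rewrite /proj (tliftE l (b_bal n)) (b_homog n gx gm).
Qed.

Lemma tgrP : is_grading tg.
Proof.
have tg0 n : tg n 0 by exact: span0.
have tgB n u v : tg n u -> tg n v -> tg n (u - v) by exact: spanB.
split=> // [|s c us gc s0 i si].
  have PB u v : (exists p, decomposed tg u p) -> (exists p, decomposed tg v p) ->
      exists p, decomposed tg (u - v) p.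
    move=> [p hp] [q hq]; exact: ex_intro _ _ (decomposedB tg0 tgB hp hq).
  have P0 : exists p, decomposed tg 0 p.
    exact: ex_intro _ _ (decomposed_homog tg0 (tg0 0)).
  have PD u v : (exists p, decomposed tg u p) -> (exists p, decomposed tg v p) ->
      exists p, decomposed tg (u + v) p.
    by move=> hu hv; rewrite -[v]opprK -[- v]sub0r; apply/PB/PB.
  apply: tens_ind => // x m.
  have [_ gx ->] := gdecP (@rgrP G) x; have [_ gm ->] := gdecP (@mgrP A M) m.
  have tB (m' : M) : zmod_morphism (fun x : G => tpure l r x m').
    by apply: zmod_morphD => ? ?; rewrite tpureDl.
  have tB' (x' : G) : zmod_morphism (fun m : M => tpure l r x' m).
    by apply: zmod_morphD => ? ?; rewrite tpureDr.
  rewrite (zmodm_sum (tB _)); elim/big_ind: _ => // i _.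
  rewrite (zmodm_sum (tB' _)); elim/big_ind: _ => // j _.
  exact: ex_intro _ _ (decomposed_homog tg0 (tgr_tpure (gx i) (gm j))).
have := congr1 (proj i) s0; rewrite (zmodm0 (projB i)) (zmodm_sum (projB i)).
rewrite (bigD1_seq i) //= (proj_tg _ (gc i)) eqxx big1 ?addr0 // => j ji.
by rewrite (proj_tg _ (gc j)) (negPf ji).
Qed.

Lemma tgrZ i j (a : A) u : rgr i a -> tg j u -> tg (i + j) (a *: u).
Proof.
move=> ga; elim=> [|v w _ hv _ hw|v [p [q [x [m [<- gx gm ->]]]]]].
- by rewrite scaler0; apply: span0.
- by rewrite scalerBr; apply: spanB.
- rewrite tpureZ addrA; apply: tgr_tpure gm; exact: rgrM (l_deg ga) gx.
Qed.

Definition tensMod : grMod A := GrMod tgrP tgrZ.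

End TensorGrading.

Lemma tgr_map (M N : grMod A) (f : M -> N) : linear f ->
  deg_preserving (@mgr A M) (@mgr A N) f ->
  deg_preserving (tgr (@mgr A M)) (tgr (@mgr A N)) (tmap l r f).
Proof.
move=> fL fd n u; elim=> [|v w _ hv _ hw|v [i [j [x [m [<- gx gm ->]]]]]].
- by rewrite (lin0 (tmap_linear fL)); apply: span0.
- by rewrite (lin_additive (tmap_linear fL)); apply: spanB.
- by rewrite (tmapE _ _ fL); apply: tgr_tpure (fd _ _ gm).
Qed.

Lemma lreg_mgrZ i j (a : A) (x : lreg l) :
  rgr i a -> @rgr G j x -> @rgr G (i + j) (a *: x).
Proof. by move=> ga gx; apply: rgrM (l_deg ga) gx. Qed.

Definition lregMod : grMod A :=
  @GrMod A (lreg l) (@rgr G) (@rgrP G) lreg_mgrZ.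

(* The multiplication of G (x)_A G, determined by
   (x (x) y) (x' (x) y') = (-1)^(|y||x'|) xx' (x) yy'; see tmulE. *)
Definition tmul_body (x y x' y' : G) : tens l r (lreg l) :=
  gsum (@rgrP G) (fun i y => gsum (@rgrP G) (fun j x' =>
    tpure l r (x * x') (y * y' : lreg l) *~ ksign i j) x') y.

Definition tmul (u v : tens l r (lreg l)) : tens l r (lreg l) :=
  tlift (fun (x : G) (y : lreg l) =>
    tlift (fun (x' : G) (y' : lreg l) => tmul_body x y x' y') v) u.

Local Notation tp := (tpure l r (M := lreg l)).

Let tpBl (m : lreg l) : zmod_morphism (fun x : G => tp x m).
Proof. by apply: zmod_morphD => x y; rewrite tpureDl. Qed.

Let tpBr (x : G) : zmod_morphism (tp x).
Proof. by apply: zmod_morphD => m n; rewrite tpureDr. Qed.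

Let zmodmz (V W : zmodType) (f : V -> W) (k : int) : zmod_morphism f ->
  {morph f : v / v *~ k}.
Proof.
move=> fB v; have nat n : f (v *+ n) = f v *+ n.
  elim: n => [|n IH]; first exact: zmodm0 fB.
  by rewrite !mulrS (zmodmD fB) IH.
case: k => n; first exact: nat.
by rewrite NegzE !mulrNz (zmodmN fB); congr (- _); exact: nat.
Qed.

Let body_x' (x y y' : G) (i j : int) : zmod_morphism (fun x' : G =>
  tp (x * x') (y * y' : lreg l) *~ ksign i j).
Proof. by move=> u v; rewrite mulrBr tpBl mulrzBl. Qed.

Let body_y (x x' y' : G) (i : int) : zmod_morphism (fun y : G =>
  gsum (@rgrP G) (fun j x' => tp (x * x') (y * y' : lreg l) *~ ksign i j) x').
Proof.
apply: zmod_morphD => u v; rewrite /gsum -big_split; apply: eq_bigr => j _ /=.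
by rewrite -mulrzDl -tpureDr; congr (tp _ _ *~ _); exact: mulrDl.
Qed.

Let tbB_y x x' y' : zmod_morphism (fun y => tmul_body x y x' y').
Proof. exact: gsum_additive (body_y x x' y'). Qed.

Let tbB_x' x y y' : zmod_morphism (fun x' => tmul_body x y x' y').
Proof.
apply: zmod_morphD => u v; rewrite /tmul_body /gsum -big_split; apply: eq_bigr => i _ /=.
exact: (zmodmD (gsum_additive _ (body_x' x _ y' i))).
Qed.

Let tbB_x y x' y' : zmod_morphism (fun x => tmul_body x y x' y').
Proof.
apply: zmod_morphD => u v; rewrite /tmul_body /gsum -big_split; apply: eq_bigr => i _ /=.
by rewrite -big_split; apply: eq_bigr => j _ /=; rewrite mulrDl tpureDl mulrzDl.
Qed.

Let tbB_y' x y x' : zmod_morphism (tmul_body x y x').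
Proof.
apply: zmod_morphD => u v; rewrite /tmul_body /gsum -big_split; apply: eq_bigr => i _ /=.
rewrite -big_split; apply: eq_bigr => j _ /=; rewrite -mulrzDl -tpureDr.
by congr (tp _ _ *~ _); exact: mulrDr.
Qed.

Lemma tmul_bodyE i j (x y x' y' : G) : rgr i y -> rgr j x' ->
  tmul_body x y x' y' = tp (x * x') (y * y') *~ ksign i j.
Proof.
move=> gy gx'; rewrite /tmul_body (gsum_homog _ (body_y x x' y') gy).
by rewrite (gsum_homog _ (body_x' x y y' i) gx').
Qed.

Let ksignDr i j k : ksign i (j + k) = ksign i j * ksign i k.
Proof. by rewrite /ksign mulrDr exprzDr. Qed.

Let ksignDl i j k : ksign (i + j) k = ksign i k * ksign j k.
Proof. by rewrite /ksign mulrDl exprzDr. Qed.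

Let tpl x a y : tp x (l a * y) = tp (x * r a) y.
Proof. by rewrite tpureA. Qed.

Lemma tmul_body_bal x y : balanced r (fun x' (y' : lreg l) => tmul_body x y x' y').
Proof.
split=> [u v m|u m n|]; [exact: zmodmD (tbB_x' x y m) _ _|exact: zmodmD (tbB_y' x y u) _ _|].
move=> x' a y'; rewrite lregZ.
move: y; apply: (gr_ext (@rgrP G)); [exact: tbB_y|exact: tbB_y|] => i y gy.
move: x'; apply: (gr_ext (@rgrP G)); [|exact: tbB_x'|] => [u v|j x' gx'].
  by rewrite mulrBl tbB_x'.
move: a; apply: (gr_ext (@rgrP A)) => [u v|u v|k a ga].
- by rewrite rmorphB mulrBr tbB_x'.
- by rewrite rmorphB mulrBl tbB_y'.
rewrite (tmul_bodyE _ _ gy (rgrM gx' (r_deg ga))) (tmul_bodyE _ _ gy gx').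
have -> : y * (l a * y') = (l a * (y * y')) *~ ksign i k.
  by rewrite mulrA (rgrC gy (l_deg ga)) mulrzAl mulrA.
by rewrite mulrA -tpl (zmodmz _ (tpBr _)) -mulrzA ksignDr mulrC.
Qed.

Lemma tmul_lift_bal (v : tens l r (lreg l)) :
  balanced r (fun (x : G) (y : lreg l) =>
    tlift (fun (x' : G) (y' : lreg l) => tmul_body x y x' y') v).
Proof.
pose L x y (w : tens l r (lreg l)) := tlift (fun (x' : G) (y' : lreg l) => tmul_body x y x' y') w.
have LB x y : zmod_morphism (L x y) by exact: tlift_additive (tmul_body_bal x y).
have LE x y x' y' : L x y (tp x' y') = tmul_body x y x' y'.
  exact: tliftE (tmul_body_bal x y) _ _.
split=> [x x' y|x y y'|x a y]; rewrite -?/(L _ _ _).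
- move: v; apply: tens_ext => [||x1 y1]; [exact: LB| |].
    by move=> u v; rewrite !LB opprD addrACA.
  by rewrite !LE (zmodmD (tbB_x _ _ _)).
- move: v; apply: tens_ext => [||x1 y1]; [exact: LB| |].
    by move=> u v; rewrite !LB opprD addrACA.
  by rewrite !LE (zmodmD (tbB_y _ _ _)).
move: v; apply: tens_ext; [exact: LB|exact: LB|] => x' y'; rewrite !LE lregZ.
move: y; apply: (gr_ext (@rgrP G)); [exact: tbB_y| |] => [u v|i y gy].
  by rewrite mulrBr tbB_y.
move: x'; apply: (gr_ext (@rgrP G)); [exact: tbB_x'|exact: tbB_x'|] => j x' gx'.
move: a; apply: (gr_ext (@rgrP A)) => [u v|u v|k a ga].
- by rewrite rmorphB mulrBr tbB_x.
- by rewrite rmorphB mulrBl tbB_y.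
rewrite (tmul_bodyE _ _ gy gx') (tmul_bodyE _ _ (rgrM (l_deg ga) gy) gx').
have -> : x * r a * x' = (x * x' * r a) *~ ksign k j.
  by rewrite -mulrA (rgrC (r_deg ga) gx') mulrzAr mulrA.
by rewrite (zmodmz _ (tpBl _)) -tpl mulrA -mulrzA ksignDl.
Qed.

Lemma tmul_pure x y x' y' : tmul (tp x y) (tp x' y') = tmul_body x y x' y'.
Proof.
rewrite /tmul (tliftE _ (tmul_lift_bal _)).
exact: (tliftE _ (tmul_body_bal x y)).
Qed.

Lemma tmulE i j (x y x' y' : G) : rgr i y -> rgr j x' ->
  tmul (tp x y) (tp x' y') = tp (x * x') (y * y') *~ ksign i j.
Proof. by move=> gy gx'; rewrite tmul_pure; apply: tmul_bodyE. Qed.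

Lemma tmulBl v : zmod_morphism (tmul^~ v).
Proof. exact: tlift_additive (tmul_lift_bal v). Qed.

Lemma tmulBr u : zmod_morphism (tmul u).
Proof.
move=> v w; move: u; apply: tens_ext => [|u u'|x y].
- exact: tmulBl.
- by rewrite !tmulBl !opprB [LHS]addrACA [RHS]addrACA; congr (_ + _); rewrite addrC.
rewrite /tmul !(tliftE _ (tmul_lift_bal _)).
exact: tlift_additive (tmul_body_bal x y) _ _.
Qed.

Lemma tmul_1l x y z : tmul (tp x y) (tp 1 z) = tp x (y * z).
Proof.
move: y; apply: (gr_ext (@rgrP G)) => [u v|u v|i y gy].
- by rewrite tpBr tmulBl.
- by rewrite mulrBl tpBr.
by rewrite (tmulE _ _ gy (@rgr1 G)) mulr1 /ksign mulr0 expr0z.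
Qed.

Lemma tmul_l1 x y z : tmul (tp z 1) (tp x y) = tp (z * x) y.
Proof.
move: x; apply: (gr_ext (@rgrP G)) => [u v|u v|i x gx].
- by rewrite tpBl tmulBr.
- by rewrite mulrBr tpBl.
by rewrite (tmulE _ _ (@rgr1 G) gx) mul1r /ksign mul0r expr0z.
Qed.


End GradedTensor.

Arguments tgr {A G} l r {M} gM n _.

(* The map G (x)_A M -> G (x)_A (G (x)_A M) obtained from D (x)_A M and the
   associativity isomorphism (x (x) y) (x) m |-> x (x) (y (x) m). *)
Definition tcomult (A G : pzRingType) (l r : {rmorphism A -> G})
    (D : G -> tens l r (lreg l)) (M : lmodType A) :
    tens l r M -> tens l r (tens l r M) :=
  tlift (fun (x : G) (m : M) => tmap l r (fun y : lreg l => tpure l r y m) (D x)).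

Record hopfAlgebroid (A G : gcRing) := HopfAlgebroid {
  etaL : {rmorphism A -> G};
  etaR : {rmorphism A -> G};
  counit : {rmorphism G -> A};
  antipode : {rmorphism G -> G};
  comult : G -> tens etaL etaR (lreg etaL);
  etaL_deg : deg_preserving (@rgr A) (@rgr G) etaL;
  etaR_deg : deg_preserving (@rgr A) (@rgr G) etaR;
  counit_deg : deg_preserving (@rgr G) (@rgr A) counit;
  antipode_deg : deg_preserving (@rgr G) (@rgr G) antipode;
  comult_deg : deg_preserving (@rgr G)
    (tgr etaL etaR (M := lreg etaL) (@rgr G)) comult;
  comultD : {morph comult : x y / x + y};
  comultM : {morph comult : x y / x * y >-> tmul x y};
  comult1 : comult 1 = tpure etaL etaR (M := lreg etaL) 1 (1 : G);
  counit_etaL : forall a, counit (etaL a) = a;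
  counit_etaR : forall a, counit (etaR a) = a;
  comult_etaL : forall a,
    comult (etaL a) = tpure etaL etaR (M := lreg etaL) (etaL a) (1 : G);
  comult_etaR : forall a,
    comult (etaR a) = tpure etaL etaR (M := lreg etaL) 1 (etaR a);
  comult_counitL : forall x,
    tlift (fun (y : G) (z : lreg etaL) => etaL (counit y) * z) (comult x) = x;
  comult_counitR : forall x,
    tlift (fun (y : G) (z : lreg etaL) => y * etaR (counit z)) (comult x) = x;
  comult_coassoc : forall x,
    tcomult comult (comult x) = tmap etaL etaR (comult : lreg etaL -> _) (comult x);
  antipode_etaL : forall a, antipode (etaL a) = etaR a;
  antipode_etaR : forall a, antipode (etaR a) = etaL a;
  antipodeK : involutive antipode;
  antipodeL : forall x,
    tlift (fun (y : G) (z : lreg etaL) => antipode y * z) (comult x) = etaR (counit x);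
  antipodeR : forall x,
    tlift (fun (y : G) (z : lreg etaL) => y * antipode z) (comult x) = etaL (counit x) }.

Arguments etaL {A G}.
Arguments etaR {A G}.
Arguments counit {A G}.
Arguments antipode {A G}.
Arguments comult {A G}.

(* The functions lifted in the counit and antipode axioms are balanced. *)
Section HopfBalanced.
Variables (A G : gcRing) (H : hopfAlgebroid A G).

Local Notation l := (etaL H).
Local Notation r := (etaR H).

Lemma counitL_bal : balanced r (fun (y : G) (z : lreg l) => l (counit H y) * z).
Proof.
split=> [x y m|x m n|x a m]; rewrite ?lregZ.
- by rewrite !rmorphD mulrDl.
- by rewrite mulrDr.
by rewrite !rmorphM counit_etaR mulrA.
Qed.

Lemma counitR_bal : balanced r (fun (y : G) (z : lreg l) => y * r (counit H z)).
Proof.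
split=> [x y m|x m n|x a m]; rewrite ?lregZ.
- by rewrite mulrDl.
- by rewrite !rmorphD mulrDr.
by rewrite !rmorphM counit_etaL mulrA.
Qed.

Lemma antipodeL_bal : balanced r (fun (y : G) (z : lreg l) => antipode H y * z).
Proof.
split=> [x y m|x m n|x a m]; rewrite ?lregZ.
- by rewrite !rmorphD mulrDl.
- by rewrite mulrDr.
by rewrite !rmorphM antipode_etaR mulrA.
Qed.

Lemma antipodeR_bal : balanced r (fun (y : G) (z : lreg l) => y * antipode H z).
Proof.
split=> [x y m|x m n|x a m]; rewrite ?lregZ.
- by rewrite mulrDl.
- by rewrite !rmorphD mulrDr.
by rewrite !rmorphM antipode_etaL mulrA.
Qed.

End HopfBalanced.

Section Comodules.
Variables (A G : gcRing) (H : hopfAlgebroid A G).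

Local Notation l := (etaL H).
Local Notation r := (etaR H).
Local Notation D := (comult H).
Local Notation T := (tens l r).
Local Notation tp := (tpure l r).

Let DB : zmod_morphism D.
Proof. exact: zmod_morphD (@comultD _ _ H). Qed.

Lemma comult_linear : linear (D : lreg l -> T (lreg l)).
Proof.
apply: linI => // a x; rewrite lregZ comultM comult_etaL.
move: (D x) => u; move: u.
apply: tens_ext => [|u v|y z]; first exact: (tmulBr (@etaL_deg _ _ H) (@etaR_deg _ _ H)).
  by rewrite scalerBr.
by rewrite (tmul_l1 (@etaL_deg _ _ H) (@etaR_deg _ _ H)) tpureZ.
Qed.

Let rmulL (z : G) : linear (fun y : lreg l => (y : G) * z : lreg l).
Proof. by move=> a u v; rewrite !lregZ; rewrite [LHS]mulrDl -mulrA. Qed.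

Lemma comult_etaRr x a :
  D (x * r a) = tmap l r (fun y : lreg l => (y : G) * r a : lreg l) (D x).
Proof.
rewrite comultM comult_etaR; move: (D x).
apply: tens_ext => [||y z]; first exact: (tmulBl (@etaL_deg _ _ H) (@etaR_deg _ _ H)).
  exact: lin_additive (tmap_linear (rmulL (r a))).
by rewrite (tmul_1l (@etaL_deg _ _ H) (@etaR_deg _ _ H)) (tmapE _ _ (rmulL (r a))).
Qed.

Section TComult.
Variable M : lmodType A.

Let tcomult_bal : balanced r
  (fun (x : G) (m : M) => tmap l r (fun y : lreg l => tp y m) (D x)).
Proof.
split=> [x y m|x m n|x a m].
- by rewrite comultD (linD (tmap_linear (tpure_linear r m))).
- move: (D x); apply: tens_ext => [|u v|y z].
  + exact: lin_additive (tmap_linear (tpure_linear r (m + n))).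
  + rewrite !(lin_additive (tmap_linear (tpure_linear r _))).
    by rewrite opprD addrACA.
  by rewrite !(tmapE _ _ (tpure_linear r _)) -tpureDr tpureDr.
rewrite comult_etaRr -[LHS](tmap_comp (tpure_linear r m) (rmulL (r a))).
by congr (tmap _ _ _ _); apply/funext => y /=; rewrite tpureA.
Qed.

Lemma tcomultE x (m : M) :
  tcomult D (tp x m) = tmap l r (fun y : lreg l => tp y m) (D x).
Proof. exact: tliftE tcomult_bal _ _. Qed.

Lemma tcomult_additive : zmod_morphism (@tcomult _ _ l r D M).
Proof. exact: tlift_additive tcomult_bal. Qed.

Lemma tcomult_linear : linear (@tcomult _ _ l r D M).
Proof.
apply: tens_lin; first exact: tcomult_additive.
move=> a x m; rewrite !tcomultE -(linZ (tmap_linear (tpure_linear r m))).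
by congr (tmap _ _ _ _); apply: (linZ comult_linear).
Qed.

Let counit_bal : balanced r (fun (x : G) (m : M) => counit H x *: m).
Proof.
split=> [x y m|x m n|x a m]; rewrite ?rmorphD ?scalerDl ?scalerDr //.
by rewrite rmorphM counit_etaR scalerA.
Qed.

Definition tcounit : T M -> M := tlift (fun (x : G) (m : M) => counit H x *: m).

Lemma tcounitE x (m : M) : tcounit (tp x m) = counit H x *: m.
Proof. exact: tliftE counit_bal _ _. Qed.

Lemma tcounit_additive : zmod_morphism tcounit.
Proof. exact: tlift_additive counit_bal. Qed.

End TComult.

Lemma tcomult_nat (M N : lmodType A) (f : M -> N) : linear f ->
  forall u, tcomult D (tmap l r f u) = tmap l r (tmap l r f) (tcomult D u).
Proof.
move=> fL; have TfL := tmap_linear (l := l) (r := r) fL.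
apply: tens_ext => [u v|u v|x m].
- by rewrite (lin_additive TfL) tcomult_additive.
- by rewrite tcomult_additive (lin_additive (tmap_linear TfL)).
rewrite (tmapE _ _ fL) !tcomultE.
rewrite -[RHS](tmap_comp TfL (tpure_linear r m)).
by congr (tmap _ _ _ _); apply/funext => y /=; rewrite (tmapE _ _ fL).
Qed.

Record grComod := GrComod {
  ccar :> grMod A;
  coact : ccar -> T ccar;
  coact_linear : linear coact;
  coact_deg : deg_preserving (@mgr A ccar) (tgr l r (@mgr A ccar)) coact;
  coact_counit : forall m, tcounit (coact m) = m;
  coact_coassoc : forall m, tcomult D (coact m) = tmap l r coact (coact m) }.

(* regComod is Gamma itself, with coaction the comultiplication. *)
Fact comult_tcounit (x : lreg l) : tcounit (D x) = x.
Proof. exact: comult_counitL. Qed.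

Definition regComod : grComod :=
  @GrComod (lregMod (@etaL_deg _ _ H)) D comult_linear (@comult_deg _ _ H)
    comult_tcounit (@comult_coassoc _ _ H).

Section ExtendedComodule.
Variable M : grMod A.

Local Notation TM := (tensMod (@etaL_deg _ _ H) (@etaR_deg _ _ H) M).

Fact ext_deg :
  deg_preserving (@mgr A TM) (tgr l r (@mgr A TM)) (tcomult D (M := M)).
Proof.
move=> n u; elim=> [|v w _ hv _ hw|v [i [j [x [m [<- gx gm ->]]]]]].
- by rewrite (lin0 (@tcomult_linear M)); apply: span0.
- by rewrite tcomult_additive; apply: spanB.
rewrite tcomultE; have rL := tmap_linear (l := l) (r := r) (tpure_linear (l := l) r m).
elim: (comult_deg H gx) => [|v1 w1 _ hv1 _ hw1|v' [p [q [y [z [<- gy gz ->]]]]]].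
- by rewrite (lin0 rL); apply: span0.
- by rewrite (lin_additive rL); apply: spanB.
rewrite (tmapE _ _ (tpure_linear r m)) -addrA; apply: tgr_tpure => //.
exact: tgr_tpure.
Qed.

Fact ext_counit (u : TM) : tcounit (tcomult D u) = u.
Proof.
move: u; apply: tens_ext => [u v|//|x m].
  by rewrite tcomult_additive tcounit_additive.
rewrite tcomultE -[in RHS](comult_tcounit x); move: (D x).
have rL := tmap_linear (l := l) (r := r) (tpure_linear (l := l) r m).
apply: tens_ext => [u v|u v|y z].
- by rewrite (lin_additive rL) tcounit_additive.
- rewrite tcounit_additive; exact: (lin_additive (tpure_linear r m)).
by rewrite (tmapE _ _ (tpure_linear r m)) !tcounitE tpureZ.
Qed.

Fact ext_coassoc (u : TM) :
  tcomult D (tcomult D u) = tmap l r (tcomult D (M := M)) (tcomult D u).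
Proof.
have dL := @tcomult_linear M; have TdL := tmap_linear (l := l) (r := r) dL.
move: u; apply: tens_ext => [u v|u v|x m].
- by rewrite !tcomult_additive.
- by rewrite tcomult_additive (lin_additive TdL).
have rL := tpure_linear (l := l) r m.
rewrite tcomultE (tcomult_nat rL) comult_coassoc.
rewrite -[LHS](tmap_comp (tmap_linear rL) comult_linear).
rewrite -[RHS](tmap_comp dL rL).
by congr (tmap _ _ _ _); apply/funext => y /=; rewrite tcomultE.
Qed.

Definition extComod : grComod :=
  @GrComod TM (tcomult D (M := M)) (@tcomult_linear M) ext_deg ext_counit ext_coassoc.

End ExtendedComodule.

Section Suspension.
Variables (n : int) (M : grComod).

Definition sgr (k : int) : M -> Prop := mgr (k - n).

Fact sgrP : is_grading sgr.
Proof.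
have [g0 gB gd gi] := @mgrP A M.
have inj_n : injective (fun k : int => k + n) by exact: addIr.
split=> [k|k u v|v|s c us gc s0 k ks].
- exact: g0.
- exact: gB.
- have [p [up gp ->]] := gd v.
  exists ([seq k + n | k <- p.1], fun k => p.2 (k - n)); split=> /= [|k|].
  + by rewrite map_inj_uniq.
  + exact: gp.
  by rewrite big_map; apply: eq_bigr => k _; rewrite addrK.
have := gi [seq k - n | k <- s] (fun k => c (k + n)).
rewrite map_inj_uniq; last exact: addIr.
move=> /(_ us) h; rewrite -[k](subrK n); apply: h.
- by move=> j; have := gc (j + n); rewrite /sgr addrK.
- by rewrite big_map -[RHS]s0; apply: eq_bigr => j _; rewrite subrK.
exact: map_f.
Qed.

Fact sgrZ i j (a : A) m : rgr i a -> sgr j m -> sgr (i + j) (a *: m).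
Proof. by move=> ga gm; rewrite /sgr -addrA; apply: mgrZ. Qed.

Definition suspMod : grMod A := GrMod sgrP sgrZ.

Fact susp_deg : deg_preserving sgr (tgr l r sgr) (@coact M).
Proof.
move=> k m gm; rewrite -[k](subrK n).
elim: (coact_deg gm) => [|v w _ hv _ hw|v [i [j [x [m' [<- gx gm' ->]]]]]].
- exact: span0.
- exact: spanB.
by rewrite -addrA; apply: tgr_tpure; rewrite // /sgr addrK.
Qed.

(* Sigma^n M: the comodule M with all degrees increased by n. *)
Definition susp : grComod :=
  @GrComod suspMod (@coact M) (@coact_linear M) susp_deg (@coact_counit M)
    (@coact_coassoc M).

End Suspension.

End Comodules.

Record grHom (A : gcRing) (M N : grMod A) := GrHom {
  gfun :> M -> N;
  grHom_linear : linear gfun;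
  grHom_deg : deg_preserving (@mgr A M) (@mgr A N) gfun }.

Lemma grHom_ext (A : gcRing) (M N : grMod A) (f g : grHom M N) :
  f =1 g -> f = g.
Proof.
case: f g => [f fL fd] [g gL gd] /= /funext fg; case: _ / fg in gL gd *.
by congr GrHom; apply: Prop_irrelevance.
Qed.

Section ComoduleHom.
Variables (A G : gcRing) (H : hopfAlgebroid A G) (M N : grComod H).

Local Notation tmap := (tmap (etaL H) (etaR H)).

Definition is_comod_hom (f : M -> N) : Prop :=
  [/\ linear f, deg_preserving (@mgr A M) (@mgr A N) f &
    forall m, coact (f m) = tmap f (coact m)].

Definition comod_hom_pred : {pred M -> N} := [pred f | `[< is_comod_hom f >]].

Lemma comod_hom_predP f : reflect (is_comod_hom f) (f \in comod_hom_pred).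
Proof. exact: asboolP. Qed.

Fact comod_hom_zmod_closed : zmod_closed comod_hom_pred.
Proof.
have cL := @coact_linear _ _ _ N.
split=> [|f g /comod_hom_predP[fL fd fc] /comod_hom_predP[gL gd gc]].
  have zL : linear (0 : M -> N) by move=> a u v; rewrite /= scaler0 addr0.
  apply/comod_hom_predP; split=> // [n m _|m]; first exact: grading0 (@mgrP _ N) _.
  rewrite (lin0 cL); move: (coact m); apply: tens_ext => [u v|//|x y].
  - by rewrite subr0.
  - exact: lin_additive (tmap_linear zL).
  by rewrite (tmapE _ _ zL); apply: (addIr (tpure _ _ x (0 : N))); rewrite -tpureDr add0r addr0.
have hE m : (f - g) m = f m - g m by [].
have hL : linear (f - g).
  by move=> a u v; rewrite !hE fL gL scalerBr opprD addrACA.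
apply/comod_hom_predP; split=> // [n m gm|m].
  exact: gradingB (@mgrP _ N) _ _ _ (fd _ _ gm) (gd _ _ gm).
rewrite -[LHS]/(coact (f m - g m)) (lin_additive cL) fc gc; move: (coact m).
apply: tens_ext => [u v|u v|x y].
- rewrite (lin_additive (tmap_linear fL)) (lin_additive (tmap_linear gL)).
  by rewrite !opprB [LHS]addrACA [RHS]addrACA; congr (_ + _); rewrite addrC.
- exact: (lin_additive (tmap_linear hL) u v).
rewrite (tmapE _ _ fL) (tmapE _ _ gL) (tmapE _ _ hL).
apply/eqP; rewrite subr_eq -tpureDr; apply/eqP.
by congr (tpure _ _ _ _); rewrite hE subrK.
Qed.

HB.instance Definition _ :=
  GRing.isZmodClosed.Build (M -> N) comod_hom_pred comod_hom_zmod_closed.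

Record comodHom := ComodHom {
  cfun :> M -> N;
  comodHom_subproof : cfun \in comod_hom_pred }.

HB.instance Definition _ := [isSub for cfun].
HB.instance Definition _ := [Choice of comodHom by <:].
HB.instance Definition _ := [SubChoice_isSubZmodule of comodHom by <:].

Lemma comodHomP (f : comodHom) : is_comod_hom f.
Proof. by apply/comod_hom_predP; case: f. Qed.

Definition mkComodHom (f : M -> N) (h : is_comod_hom f) : comodHom :=
  ComodHom (introT (comod_hom_predP f) h).

Lemma comodHom_ext (f g : comodHom) : f =1 g -> f = g.
Proof. by move=> /funext fg; apply: val_inj. Qed.

End ComoduleHom.

(* hom(M, N) as a graded abelian group: in degree n, the grading-preserving
   comodule homomorphisms Sigma^n M -> N. *)
Definition homGr (A G : gcRing) (H : hopfAlgebroid A G) (M N : grComod H)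
  (n : int) : zmodType := comodHom (susp n M) N.

Section HomogeneousPart.
Variables (A : gcRing) (M : grMod A) (n : int).

Definition homog_pred : {pred M} := [pred m | `[< mgr n m >]].

Fact homog_zmod_closed : zmod_closed homog_pred.
Proof.
split=> [|u v]; rewrite !unfold_in.
  exact/asboolP/(grading0 (@mgrP _ M)).
by move=> /asboolP gu /asboolP gv; exact/asboolP/(gradingB (@mgrP _ M)).
Qed.

HB.instance Definition _ := GRing.isZmodClosed.Build M homog_pred homog_zmod_closed.

Record homogPart := HomogPart {
  hval :> M;
  homogPart_subproof : hval \in homog_pred }.

HB.instance Definition _ := [isSub for hval].
HB.instance Definition _ := [Choice of homogPart by <:].
HB.instance Definition _ := [SubChoice_isSubZmodule of homogPart by <:].

End HomogeneousPart.

(* The underlying graded abelian group of a graded module. *)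
Definition grPart (A : gcRing) (M : grMod A) (n : int) : zmodType :=
  homogPart M n.

Record category := Category {
  obj :> Type;
  hom : obj -> obj -> Type;
  idm : forall X, hom X X;
  mcomp : forall X Y Z, hom Y Z -> hom X Y -> hom X Z;
  comp1m : forall X Y (f : hom X Y), mcomp (idm Y) f = f;
  compm1 : forall X Y (f : hom X Y), mcomp f (idm X) = f;
  compA : forall X Y Z W (f : hom Z W) (g : hom Y Z) (h : hom X Y),
    mcomp f (mcomp g h) = mcomp (mcomp f g) h }.

Record functor (C D : category) := Functor {
  fobj :> C -> D;
  fmap : forall X Y, hom X Y -> hom (fobj X) (fobj Y);
  fmap_id : forall X, fmap (idm X) = idm (fobj X);
  fmap_comp : forall X Y Z (f : hom Y Z) (g : hom X Y),
    fmap (mcomp f g) = mcomp (fmap f) (fmap g) }.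

(* F is left adjoint to U. *)
Record adjunction (C D : category) (F : functor C D) (U : functor D C) :=
  Adjunction {
  adj : forall X Y, hom (F X) Y -> hom X (U Y);
  adj_bij : forall X Y, bijective (@adj X Y);
  adj_natl : forall X X' Y (f : hom X' X) (g : hom (F X) Y),
    adj (mcomp g (fmap F f)) = mcomp (adj g) f;
  adj_natr : forall X Y Y' (f : hom Y Y') (g : hom (F X) Y),
    adj (mcomp f g) = mcomp (fmap U f) (adj g) }.

Section GrModCategory.
Variable A : gcRing.

Definition grHom_id (M : grMod A) : grHom M M :=
  @GrHom A M M id (fun _ _ _ => erefl) (fun _ _ h => h).

Fact grHom_comp_linear (M N P : grMod A) (f : grHom N P) (g : grHom M N) :
  linear (f \o g).
Proof. by move=> a u v; rewrite /= !grHom_linear. Qed.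

Definition grHom_comp (M N P : grMod A) (f : grHom N P) (g : grHom M N) :
    grHom M P :=
  GrHom (grHom_comp_linear f g)
    (fun n m h => grHom_deg f (grHom_deg g h)).

Definition grModCat : category.
Proof.
refine (@Category (grMod A) (@grHom A) grHom_id grHom_comp _ _ _);
  by move=> *; apply: grHom_ext.
Defined.

End GrModCategory.

Section GrComodCategory.
Variables (A G : gcRing) (H : hopfAlgebroid A G).

Fact comod_id_proof (M : grComod H) : is_comod_hom (@id M).
Proof. by split=> // m; rewrite tmap_id. Qed.

Fact comod_comp_proof (M N P : grComod H) (f : comodHom N P) (g : comodHom M N) :
  is_comod_hom (f \o g).
Proof.
have [[fL fd fc] [gL gd gc]] := (comodHomP f, comodHomP g).
split=> [a u v|n m gm|m]; first by rewrite /= gL fL.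
  exact/fd/gd.
by rewrite (tmap_comp fL gL) /= fc gc.
Qed.

Definition comodHom_id (M : grComod H) : comodHom M M :=
  mkComodHom (comod_id_proof M).

Definition comodHom_comp (M N P : grComod H) (f : comodHom N P)
  (g : comodHom M N) : comodHom M P := mkComodHom (comod_comp_proof f g).

Definition grComodCat : category.
Proof.
refine (@Category (grComod H) (@comodHom A G H)
  comodHom_id comodHom_comp _ _ _);
  by move=> *; apply: comodHom_ext.
Defined.

Fact ext_hom_proof (M N : grMod A) (f : grHom M N) :
  @is_comod_hom A G H (extComod H M) (extComod H N) (tmap (etaL H) (etaR H) f).
Proof.
have fL := grHom_linear f; split; first exact: tmap_linear.
  exact: (@tgr_map A G (etaL H) (etaR H) M N f fL (@grHom_deg _ _ _ f)).
by move=> u; rewrite [LHS](tcomult_nat fL).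
Qed.

(* E(M) = Gamma (x)_A M *)
Definition extFunctor : functor (grModCat A) grComodCat.
Proof.
refine (@Functor (grModCat A) grComodCat (extComod H)
  (fun M N f => mkComodHom (ext_hom_proof f)) _ _).
- by move=> M; apply: comodHom_ext => u; apply: tmap_id.
- move=> M N P f g; apply: comodHom_ext => u.
  exact: (tmap_comp (@grHom_linear _ _ _ f) (@grHom_linear _ _ _ g)).
Defined.

Definition exact_at (X Y Z : zmodType) (f : X -> Y) (g : Y -> Z) : Prop :=
  forall y, g y = 0 <-> exists x, f x = y.

(* Flatness of Gamma as a right A-module, i.e. along etaR. *)
Definition flat : Prop :=
  forall (M N P : grMod A) (f : grHom M N) (g : grHom N P),
    exact_at f g ->
    exact_at (tmap (etaL H) (etaR H) f) (tmap (etaL H) (etaR H) g).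

End GrComodCategory.

(* Main.v *)
(* A right adjoint of E is constructed by hand: V N is the direct sum over n of
   the hom(Sigma^n Gamma, N), on which A acts by (a g)(x) = g(x etaR(a)); right
   multiplication is left linear and colinear, and no Koszul sign appears.  A
   comodule map f : Gamma (x)_A M -> N corresponds to m |-> (x |-> f(x (x) m)).
   Any other right adjoint is naturally isomorphic to this one, by isomorphisms
   of graded modules, which are additive in each degree. *)
From HB Require Import structures.
From mathcomp Require Import all_boot all_algebra.
From mathcomp Require Import boolp classical_sets functions.
Require Import Defs.

Set Implicit Arguments.
Unset Strict Implicit.
Unset Printing Implicit Defensive.

Import GRing.Theory.
Local Open Scope ring_scope.

(** * Uniqueness of right adjoints *)

Section AdjointUniqueness.
Variables (C D : category) (F : functor C D) (U U' : functor D C).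
Variables (a : adjunction F U) (a' : adjunction F U').

(** Each comparison map is the counit of one adjunction, transposed along the other. *)
Lemma right_adjoint_iso : exists (t : forall Y, hom (U Y) (U' Y))
    (s : forall Y, hom (U' Y) (U Y)),
  [/\ forall Y, mcomp (t Y) (s Y) = idm (U' Y),
      forall Y, mcomp (s Y) (t Y) = idm (U Y) &
      forall Y Z (f : hom Y Z), mcomp (fmap U' f) (t Y) = mcomp (t Z) (fmap U f)].
Proof.
have inv (W : functor D C) (b : adjunction F W) X Y :
    exists c : hom X (W Y) -> hom (F X) Y,
      cancel (adj b (Y := Y)) c /\ cancel c (adj b (Y := Y)).
  by have [c cK Kc] := adj_bij b X Y; exists c.
(* The counits [e] and [e'] are the preimages of identities; [invE] and [invE'] use them to recover
   a map from its transpose. *)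
pose e Y := sval (cid (inv _ a (U Y) Y)) (idm (U Y)).
pose e' Y := sval (cid (inv _ a' (U' Y) Y)) (idm (U' Y)).
have eE Y : adj a (e Y) = idm (U Y).
  by rewrite /e; case: (cid _) => c [/= _ ->].
have eE' Y : adj a' (e' Y) = idm (U' Y).
  by rewrite /e'; case: (cid _) => c [/= _ ->].
have invE Y X (g : hom (F X) Y) : mcomp (e Y) (fmap F (adj a g)) = g.
  by apply: (bij_inj (adj_bij a X Y)); rewrite adj_natl eE comp1m.
have invE' Y X (g : hom (F X) Y) : mcomp (e' Y) (fmap F (adj a' g)) = g.
  by apply: (bij_inj (adj_bij a' X Y)); rewrite adj_natl eE' comp1m.
exists (fun Y => adj a' (e Y)), (fun Y => adj a (e' Y)); split=> [Y|Y|Y Z f].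
- by rewrite -adj_natl invE.
- by rewrite -adj_natl invE'.
(* Both sides are transposes along [a'], so naturality of the counit [e] suffices; it is checked
   after transposing along [a]. *)
rewrite -adj_natr -adj_natl; congr (adj _ _).
by apply: (bij_inj (adj_bij a (U Y) Z)); rewrite adj_natl adj_natr !eE compm1 comp1m.
Qed.

End AdjointUniqueness.

(** * The graded module of maps from Gamma to a comodule *)

Section GradedHom.
Variables (A G : gcRing) (H : hopfAlgebroid A G).

Local Notation l := (etaL H).
Local Notation r := (etaR H).
Local Notation D := (comult H).
Local Notation tp := (tpure l r).

Section Object.
Variable N : grComod H.

(** Suspension changes only the grading, so the maps from all the Sigma^n Gamma are functions on one
    set and can be added across degrees. *)
Definition hom_degree (n : int) (g : G -> N) : Prop :=
  @is_comod_hom A G H (susp n (regComod H)) N g.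

Definition hom_span : (G -> N) -> Prop := span (fun g => exists n, hom_degree n g).

(* The sum over n of the hom(Sigma^n Gamma, N), as maps Gamma -> N. *)
Record gammaHom := GammaHom {
  ghval :> G -> N;
  gammaHom_subproof : ghval \in span_pred (fun g => exists n, hom_degree n g) }.

HB.instance Definition _ := [isSub for ghval].
HB.instance Definition _ := [Choice of gammaHom by <:].
HB.instance Definition _ := [SubChoice_isSubZmodule of gammaHom by <:].

Lemma gammaHomP (g : gammaHom) : hom_span g.
Proof. by apply/span_predP; case: g. Qed.

Definition mkGammaHom (g : G -> N) (h : hom_span g) : gammaHom :=
  GammaHom (introT (span_predP _ g) h).

Lemma gammaHom_ext (g h : gammaHom) : ghval g =1 h -> g = h.
Proof. by move=> /funext gh; apply: val_inj. Qed.

Lemma ghvalD (g h : gammaHom) x : (g + h) x = g x + h x. Proof. by []. Qed.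
Lemma ghval0 x : (0 : gammaHom) x = 0. Proof. by []. Qed.

Lemma ghval_sum (I : Type) (s : seq I) (c : I -> gammaHom) x :
  (\sum_(i <- s) c i) x = \sum_(i <- s) c i x.
Proof. exact: (zmodm_sum (f := fun g : gammaHom => g x) (fun _ _ => erefl)). Qed.

Lemma hom_degreeB n g h : hom_degree n g -> hom_degree n h -> hom_degree n (g - h).
Proof.
have [_ cB] := @comod_hom_zmod_closed A G H (susp n (regComod H)) N.
by move=> /comod_hom_predP hg /comod_hom_predP hh; apply/comod_hom_predP/cB.
Qed.

Lemma hom_degree0 n : hom_degree n 0.
Proof.
by have [c0 _] := @comod_hom_zmod_closed A G H (susp n (regComod H)) N; apply/comod_hom_predP.
Qed.

Lemma gammaHom_linear (g : gammaHom) : linear (g : lreg l -> N).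
Proof.
elim: (gammaHomP g) => [|u v _ hu _ hv|u [n [uL _ _]]] //.
- by move=> a x y; rewrite -[LHS]/(0 : N) scaler0 addr0.
move=> a x y; have e z : (u - v) z = u z - v z by [].
by rewrite !e hu hv scalerBr opprD addrACA.
Qed.

Lemma mul_etaR_linear a : linear (fun x : lreg l => (x : G) * r a : lreg l).
Proof. by move=> b x y; rewrite [LHS]mulrDl -mulrA. Qed.

(** Right multiplication by [r a] commutes with the comultiplication by [comult_etaRr] and raises
    degrees by [i]. *)
Lemma hom_degreeM i n a g : rgr i a -> hom_degree n g ->
  hom_degree (i + n) (fun x => g (x * r a)).
Proof.
move=> ga [gL gd gc]; have aL := mul_etaR_linear a; split=> [b x y|k x gx|x].
- by rewrite -gL; congr g; apply: aL.
(* Degree [k] in Sigma^(i + n) Gamma is degree [k - n - i] in Gamma; multiplying by [r a] brings it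
   to [k - n], as [g] expects. *)
- apply: gd; rewrite /= /sgr -[k - n](subrK i) -[k - n - i]addrA -opprD [n + i]addrC.
  exact: rgrM gx (@etaR_deg _ _ H _ _ ga).
by rewrite gc /= comult_etaRr -[LHS](tmap_comp gL aL).
Qed.

(** As [a] need not be homogeneous, the map is split along the components of [a], each of which
    falls under [hom_degreeM]. *)
Lemma hom_spanM a g : hom_span g -> hom_span (fun x => g (x * r a)).
Proof.
elim=> [|u v _ hu _ hv|u [n hu]]; [exact: span0|exact: spanB|].
have uL : zmod_morphism (u : lreg l -> N) by case: hu => uL _ _; apply: lin_additive uL.
have [_ ga ->] := gdecP (@rgrP A) a.
rewrite (_ : (fun x => _) =
  \sum_(i <- (gdec (@rgrP A) a).1) (fun x => u (x * r ((gdec (@rgrP A) a).2 i)))).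
  elim/big_ind: _ => [||i _]; [exact: span0|exact: spanD|].
  by apply: span_gen; exists (i + n); apply: hom_degreeM.
apply/funext => x; rewrite fct_sumE rmorph_sum mulr_sumr.
exact: (zmodm_sum uL).
Qed.

Definition gammaHom_scale (a : A) (g : gammaHom) : gammaHom :=
  mkGammaHom (hom_spanM a (gammaHomP g)).

Fact gammaHom_scaleA a b g :
  gammaHom_scale a (gammaHom_scale b g) = gammaHom_scale (a * b) g.
Proof. by apply: gammaHom_ext => x /=; rewrite rmorphM mulrA. Qed.

Fact gammaHom_scale1 : left_id 1 gammaHom_scale.
Proof. by move=> g; apply: gammaHom_ext => x /=; rewrite rmorph1 mulr1. Qed.

Fact gammaHom_scaleDr : right_distributive gammaHom_scale +%R.
Proof. by move=> a g h; apply: gammaHom_ext. Qed.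

Fact gammaHom_scaleDl g : {morph gammaHom_scale^~ g : a b / a + b}.
Proof.
move=> a b; apply: gammaHom_ext => x; rewrite ghvalD /= rmorphD mulrDr.
exact: linD (gammaHom_linear g) _ _.
Qed.

HB.instance Definition _ := GRing.Zmodule_isLmodule.Build A gammaHom
  gammaHom_scaleA gammaHom_scale1 gammaHom_scaleDr gammaHom_scaleDl.

Lemma ghvalZ a (g : gammaHom) x : (a *: g) x = g (x * r a).
Proof. by []. Qed.

(** Decompositions are built by induction on the span. Independence is tested at a homogeneous [x],
    where maps of distinct degrees take values in distinct degrees of [N]. *)
Fact gammaHom_grP : is_grading (fun n (g : gammaHom) => hom_degree n g).
Proof.
pose gr n (g : gammaHom) := hom_degree n g.
have d0 n : gr n 0 by exact: hom_degree0.
have dB n g h : gr n g -> gr n h -> gr n (g - h) by exact: hom_degreeB.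
split=> // [g|s c us gc s0 i si].
  (* The membership proof stays general in the induction; [val_inj] makes the choice of it
     irrelevant. *)
  case: g => g hg; elim: (elimT (span_predP _ g) hg) (hg) => {g hg} [h0|u v hu Iu hv Iv h|u [n un] h].
  - rewrite (_ : GammaHom h0 = 0); last exact: val_inj.
    by eexists; exact: (decomposed_homog d0 (d0 0)).
  - have hu' := introT (span_predP _ _) hu; have hv' := introT (span_predP _ _) hv.
    have [[p hp] [q hq]] := (Iu hu', Iv hv').
    rewrite (_ : GammaHom h = GammaHom hu' - GammaHom hv'); last exact: val_inj.
    by eexists; exact: (decomposedB d0 dB hp hq).
  have gn : gr n (GammaHom h) by [].
  by eexists; exact: (decomposed_homog d0 gn).
apply: gammaHom_ext; apply: (gr_ext (@rgrP G)) => [|x y|k x gx].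
- exact: lin_additive (gammaHom_linear (c i)).
- by rewrite !ghval0 subr0.
(* The sum is reindexed by degrees of [N]: [c j] sends [x] to degree [j + k]. *)
have e : \sum_(j <- [seq j + k | j <- s]) c (j - k) x = 0.
  rewrite big_map -[RHS](ghval0 x) -s0 ghval_sum.
  by apply: eq_bigr => j _; rewrite addrK.
have := grading_indep (@mgrP A N) (c := fun j => c (j - k) x) _ _ e.
rewrite map_inj_uniq; last exact: addIr.
move=> /(_ us) h; have := h _ (i + k); rewrite addrK; apply; last exact: map_f.
move=> j; have [_ + _] := gc (j - k); apply.
by rewrite /= /sgr /= subKr.
Qed.

Fact gammaHom_grZ i j (a : A) (g : gammaHom) :
  rgr i a -> hom_degree j g -> hom_degree (i + j) (a *: g).
Proof. exact: hom_degreeM. Qed.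

Definition gammaHomMod : grMod A := GrMod gammaHom_grP gammaHom_grZ.

End Object.

(** * Functoriality by postcomposition *)

Section Map.
Variables (M N : grComod H) (f : comodHom M N).

Lemma hom_degree_comp n (g : G -> M) : hom_degree n g -> hom_degree n (f \o g).
Proof.
by move=> hg; exact: (@comod_comp_proof A G H (susp n (regComod H)) M N f (mkComodHom hg)).
Qed.

Lemma hom_span_comp (g : G -> M) : hom_span g -> hom_span (f \o g).
Proof.
have [fL _ _] := comodHomP f.
elim=> [|u v _ hu _ hv|u [n hu]].
- rewrite (_ : f \o _ = 0); first exact: span0.
  by apply/funext => x; apply: lin0 fL.
- rewrite (_ : f \o _ = (f \o u) - (f \o v)); first exact: spanB.
  by apply/funext => x; apply: lin_additive fL _ _.
by apply: span_gen; exists n; apply: hom_degree_comp.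
Qed.

Definition gammaHom_map (g : gammaHomMod M) : gammaHomMod N :=
  mkGammaHom (hom_span_comp (gammaHomP g)).

Fact gammaHom_map_linear : linear gammaHom_map.
Proof.
have [fL _ _] := comodHomP f.
by move=> a g h; apply: gammaHom_ext => x; apply: linD fL _ _.
Qed.

Fact gammaHom_map_deg :
  deg_preserving (@mgr A (gammaHomMod M)) (@mgr A (gammaHomMod N)) gammaHom_map.
Proof. by move=> n g; apply: hom_degree_comp. Qed.

Definition gammaHom_grHom : grHom (gammaHomMod M) (gammaHomMod N) :=
  GrHom gammaHom_map_linear gammaHom_map_deg.

End Map.

Definition gammaHomFunctor : functor (grComodCat H) (grModCat A).
Proof.
refine (@Functor (grComodCat H) (grModCat A) gammaHomMod gammaHom_grHom _ _).
- by move=> M; apply: grHom_ext => g; apply: gammaHom_ext.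
- by move=> M N P f g; apply: grHom_ext => h; apply: gammaHom_ext.
Defined.

(** * The adjunction with the extended comodule functor *)

Section Adjunction.
Variables (M : grMod A) (N : grComod H).

(** By [tcomultE], tensoring with [m] is a comodule map from Gamma to the extended comodule raising
    degrees by [j]; [f] is composed with it. *)
Lemma hom_degree_tpure j (f : comodHom (extComod H M) N) m :
  mgr j m -> hom_degree j (fun x => f (tp x m)).
Proof.
move=> gm; have [fL fd fc] := comodHomP f.
have tL := tpure_linear (l := l) r m.
split=> [b x y|k x gx|x].
- by rewrite -fL; congr (f _); apply: tL.
- by apply: fd; rewrite -[k](subrK j); apply: tgr_tpure.
by rewrite fc /= tcomultE -[LHS](tmap_comp fL tL).
Qed.

Lemma hom_span_tpure (f : comodHom (extComod H M) N) m :
  hom_span (fun x => f (tp x m)).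
Proof.
have [fL _ _] := comodHomP f.
have [_ gm ->] := gdecP (@mgrP A M) m.
rewrite (_ : (fun x => _) =
  \sum_(i <- (gdec (@mgrP A M) m).1) (fun x => f (tp x ((gdec (@mgrP A M) m).2 i)))).
  elim/big_ind: _ => [||i _]; [exact: span0|exact: spanD|].
  by apply: span_gen; exists i; apply: hom_degree_tpure.
apply/funext => x; rewrite fct_sumE.
rewrite (zmodm_sum (f := tp x) (zmod_morphD (fun m n => tpureDr l r x m n))).
exact: (zmodm_sum (lin_additive fL)).
Qed.

Definition gammaHom_curry_fun (f : comodHom (extComod H M) N) (m : M) :
    gammaHomMod N :=
  mkGammaHom (hom_span_tpure f m).

(** Compatibility with scalars is the tensor relation [tpureA], which is what forces [A] to act on
    maps through [etaR]. *)
Fact gammaHom_curry_linear f : linear (gammaHom_curry_fun f).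
Proof.
have [fL _ _] := comodHomP f.
move=> a m n; apply: gammaHom_ext => x; rewrite ghvalD ghvalZ /=.
by rewrite tpureDr (linD fL) tpureA.
Qed.

Definition gammaHom_curry (f : comodHom (extComod H M) N) : grHom M (gammaHomMod N) :=
  GrHom (gammaHom_curry_linear f) (fun n m gm => hom_degree_tpure f gm).

Definition gammaHom_uncurry_fun (h : grHom M (gammaHomMod N)) : extComod H M -> N :=
  tlift (fun (x : G) (m : M) => h m x).

Section Uncurry.
Variable h : grHom M (gammaHomMod N).

Lemma uncurry_bal : balanced r (fun (x : G) (m : M) => h m x).
Proof.
have hL := grHom_linear h; split=> [x y m|x m n|x a m].
- exact: linD (gammaHom_linear (h m)) _ _.
- by rewrite (linD hL).
by rewrite (linZ hL).
Qed.

Lemma gammaHom_uncurryE x m : gammaHom_uncurry_fun h (tp x m) = h m x.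
Proof. exact: tliftE uncurry_bal _ _. Qed.

(** Colinearity does not mention degrees and is additive in the map, so it passes from the
    homogeneous components to [g]. *)
Lemma gammaHom_coact (g : gammaHom N) x : coact (g x) = tmap l r (g : lreg l -> N) (D x).
Proof.
have cL := @coact_linear _ _ _ N.
have [_ gg gE] := gdecP (gammaHom_grP N) g.
set s := (gdec _ g).1 in gE; set c := (gdec _ g).2 in gg gE.
have -> : g x = \sum_(i <- s) c i x by rewrite {1}gE ghval_sum.
rewrite (zmodm_sum (lin_additive cL)).
under eq_bigr => i _ do have [_ _ ->] := gg i.
rewrite /=; move: (D x); apply: tens_ext => [u v||y z].
- rewrite -sumrB; apply: eq_bigr => i _.
  exact: lin_additive (tmap_linear (gammaHom_linear (c i))) _ _.
- exact: lin_additive (tmap_linear (gammaHom_linear g)).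
under eq_bigr do rewrite (tmapE _ _ (gammaHom_linear _)).
rewrite (tmapE _ _ (gammaHom_linear _)).
rewrite [X in tp y X](_ : _ = \sum_(i <- s) c i z); last by rewrite {1}gE ghval_sum.
by rewrite (zmodm_sum (f := tp y) (zmod_morphD (fun m n => tpureDr l r y m n))).
Qed.

Fact gammaHom_uncurry_proof : is_comod_hom (gammaHom_uncurry_fun h).
Proof.
have uL : linear (gammaHom_uncurry_fun h).
  apply: tens_lin => [|a x m]; first exact: tlift_additive uncurry_bal.
  by rewrite !gammaHom_uncurryE -(linZ (gammaHom_linear (h m))).
split=> // [n u|].
  elim=> [|v w _ hv _ hw|v [i [j [x [m [<- gx gm ->]]]]]].
  - by rewrite (lin0 uL); apply: grading0 (@mgrP _ N) _.
  - by rewrite (lin_additive uL); apply: gradingB (@mgrP _ N) _ _ _ hv hw.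
  (* Since [m] has degree [j], [h m] is a map from Sigma^j Gamma, where [x] has degree [i + j]. *)
  rewrite gammaHom_uncurryE; have [_ + _] := grHom_deg h gm; apply.
  by rewrite /= /sgr addrK.
apply: tens_ext => [u v|u v|x m].
- by rewrite (lin_additive uL) (lin_additive (@coact_linear _ _ _ N)).
- by rewrite /= tcomult_additive (lin_additive (tmap_linear uL)).
rewrite gammaHom_uncurryE gammaHom_coact /= tcomultE.
rewrite -[RHS](tmap_comp uL (tpure_linear r m)).
by congr (tmap _ _ _ _); apply/funext => y; rewrite /= gammaHom_uncurryE.
Qed.

Definition gammaHom_uncurry : comodHom (extComod H M) N :=
  mkComodHom gammaHom_uncurry_proof.

End Uncurry.

Lemma gammaHom_curry_bij : bijective gammaHom_curry.
Proof.
exists gammaHom_uncurry => [f|h].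
  apply: comodHom_ext; have [fL _ _] := comodHomP f.
  apply: tens_ext => [||x m].
  - exact: tlift_additive (uncurry_bal _).
  - exact: lin_additive fL.
  exact: gammaHom_uncurryE.
apply: grHom_ext => m; apply: gammaHom_ext => x.
exact: gammaHom_uncurryE.
Qed.

End Adjunction.

Definition gammaHom_adjunction : adjunction (extFunctor H) gammaHomFunctor.
Proof.
refine (@Adjunction (grModCat A) (grComodCat H) (extFunctor H) gammaHomFunctor
  gammaHom_curry gammaHom_curry_bij _ _).
- move=> M M' N f g; apply: grHom_ext => m; apply: gammaHom_ext => x /=.
  by rewrite (tmapE _ _ (grHom_linear f)).
- by move=> M N N' f g; apply: grHom_ext => m; apply: gammaHom_ext.
Defined.

(** * Transport to an arbitrary right adjoint *)

Definition gammaHom_of (N : grComod H) n (g : homGr (regComod H) N n) : gammaHomMod N :=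
  mkGammaHom (span_gen (ex_intro _ n (comodHomP g))).

End GradedHom.

Theorem proposition3p2 (A G : gcRing) (H : hopfAlgebroid A G) (Gflat : flat H) :
  (exists V : functor (grComodCat H) (grModCat A),
     inhabited (adjunction (extFunctor H) V))
  /\
  (forall V : functor (grComodCat H) (grModCat A),
     adjunction (extFunctor H) V ->
     exists phi : forall (M : grComod H) (n : int),
         {additive homGr (regComod H) M n -> grPart (V M) n},
       (forall (M : grComod H) (n : int), bijective (phi M n)) /\
       (forall (M N : grComod H) (f : comodHom M N) (n : int)
           (g : homGr (regComod H) M n),
         hval (phi N n (comodHom_comp f g))
         = fmap V f (hval (phi M n g)))).
Proof.
split; first by exists (gammaHomFunctor H); split; exact: gammaHom_adjunction.
move=> V aV; have [t [s [ts st nat]]] := right_adjoint_iso (gammaHom_adjunction H) aV.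
have tsE M v : t M (s M v) = v by exact: (congr1 (fun h : grHom (V M) (V M) => h v) (ts M)).
have stE M v : s M (t M v) = v 
  by exact: (congr1 (fun h : grHom (gammaHomMod M) (gammaHomMod M) => h v) (st M)).
have homogP M n (v : grPart (V M) n) : mgr n (hval v).
  by case: v => v /= /asboolP.
have phiP M n (g : homGr (regComod H) M n) :
    t M (gammaHom_of g) \in homog_pred (M := V M) n.
  by apply/asboolP; apply: grHom_deg; apply: comodHomP.
pose phi M n (g : homGr (regComod H) M n) : grPart (V M) n := HomogPart (phiP M n g).
have phiB M n : zmod_morphism (@phi M n).
  move=> g h; apply: val_inj => /=; rewrite -(lin_additive (grHom_linear (t M))).
  by congr (t M _); apply: gammaHom_ext.
pose phi_add M n : {additive homGr (regComod H) M n -> grPart (V M) n} :=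
  HB.pack (@phi M n) (GRing.isZmodMorphism.Build _ _ _ (phiB M n)).
exists phi_add.
split=> [M n|M N f n g] /=.
  (* The inverse of [phi] is [s]: it preserves degrees, and an element of degree [n] in
     [gammaHomMod M] is by definition a comodule map from Sigma^n Gamma. *)
  have sP (v : grPart (V M) n) : is_comod_hom (M := susp n (regComod H)) (s M (hval v)).
    by have := grHom_deg (s M) (homogP _ _ v).
  exists (fun v => mkComodHom (sP v)) => [g|v].
    by apply: comodHom_ext => x /=; rewrite stE.
  apply: val_inj => /=; rewrite -[RHS]tsE; congr (t M _).
  exact: gammaHom_ext.
(* [gammaHomFunctor] acts by composition with [f], so the claim is the naturality of [t] evaluated
   at [g]. *)
have := congr1 (fun h : grHom (gammaHomMod M) (V N) => h (gammaHom_of g)) (nat M N f) => /= ->.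
by congr (t N _); apply: gammaHom_ext.
Qed.
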